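(* Let $n,k\ge1$, $X=[-1,1]^n$, and for $\beta\in\mathbb{R}^n$ with all $\beta_j>0$ let $\gamma_\beta(g)=\sum_{j=1}^n\beta_j|g_j|$. For any stepsize $\alpha\ge0$ and any such $\beta$, there exist vectors $g_1,\dots,g_k\in\mathbb{R}^n$ with $\gamma_\beta(g_i)\le1$ and a point $x\in X$ such that $$\mathrm{Regret}_{k,\alpha}(x)\ \ge\ \frac12\min\Big\{\frac{nk}{2\|\beta\|_1},\ \frac{\sqrt{2nk}}{\min_{j\le n}\beta_j}\Big\}.$$
   Context: $\mathrm{Regret}_{k,\alpha}(x)=\sum_{i\le k}g_i^\top(x_i-x)$ denotes the regret of the online gradient descent method with fixed stepsize $\alpha$ for the linear functions $x\mapsto g_i^\top x$, i.e. $x_1=0$ and $x_{i+1}=x_i-\alpha g_i$ (unconstrained updates). *)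

(* Defs.v *)
From mathcomp Require Import all_boot all_order all_algebra.
From mathcomp Require Import reals.

Set Implicit Arguments.
Unset Strict Implicit.
Unset Printing Implicit Defensive.

Import Order.TTheory GRing.Theory Num.Theory.
Local Open Scope ring_scope.

Definition dotp (R : realType) (n : nat) (u v : 'cV[R]_n) : R :=
  (u^T *m v) 0 0.

(* The library norm on matrices is the sup norm, hence this definition. *)
Definition norm1 (R : realType) (n : nat) (u : 'cV[R]_n) : R :=
  \sum_(j < n) `|u j 0|.

Definition gauge (R : realType) (n : nat) (beta g : 'cV[R]_n) : R :=
  \sum_(j < n) beta j 0 * `|g j 0|.

Definition min_entry (R : realType) (n : nat) (n_gt0 : (0 < n)%N)
    (u : 'cV[R]_n) : R :=
  u [arg min_(j < Ordinal n_gt0) u j 0]%O 0.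

Definition in_cube (R : realType) (n : nat) (x : 'cV[R]_n) : Prop :=
  forall j : 'I_n, -1 <= x j 0 <= 1.

(* Indices are shifted by one: [ogd alpha g i] is x_(i+1), [g`_i] is g_(i+1). *)
Fixpoint ogd (R : realType) (n : nat) (alpha : R) (g : seq 'cV[R]_n)
    (i : nat) : 'cV[R]_n :=
  if i is i'.+1 then ogd alpha g i' - alpha *: g`_i' else 0.

Definition regret (R : realType) (n k : nat) (alpha : R)
    (g : k.-tuple 'cV[R]_n) (x : 'cV[R]_n) : R :=
  \sum_(i < k) dotp (tnth g i) (ogd alpha g i - x).

(* Main.v *)
Require Import Defs.
From mathcomp Require Import all_boot all_order all_algebra.
From mathcomp Require Import reals.
From mathcomp Require Import ring lra.

Set Implicit Arguments.
Unset Strict Implicit.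
Unset Printing Implicit Defensive.

Import Order.TTheory GRing.Theory Num.Theory.
Local Open Scope ring_scope.

(** Since [x_(i+1) = x_i - alpha g_i], the regret depends on the [g_i] only
    through their sum [G] and the sum of their squared lengths:

      [Regret(x) = alpha/2 (\sum_i |g_i|^2 - |G|^2) - G . x]   ([regretE]).

    The adversary therefore wants long vectors whose sum stays moderate.  It
    plays [g_i = c 1 + (-1)^i d e_j]: the drift [c 1] favours the comparator
    [x = - 1], towards which the iterates move only gradually, while the
    oscillation along one axis [e_j] adds to the squared lengths and almost
    cancels in [G].  As long as [alpha c (k - 1) <= 1] this yields
    ([regret_zigzag_ge])

      [Regret(- 1) >= k c n - alpha k (k - 1) n c^2 / 2
                      + alpha (k - 1) d^2 / 2].

    The gauge bound amounts to [c |beta|_1 + d beta_j <= 1].  Write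
    [B = |beta|_1] and [b = beta_j].
    - If [alpha (k - 1) <= B], pure drift [c = 1 / B], [d = 0] gives
      [n k / (2 B)], twice what is needed.
    - Otherwise let the drift end at the comparator, [c = 1 / (alpha k)], and
      spend the rest of the gauge budget on oscillation,
      [d = (1 - c B) / b].  In the variable [u = alpha k], the claim that the
      resulting bound is at least [T] says that a quadratic polynomial in [u] is
      nonnegative.  Here [k >= 2], and then its discriminant is nonpositive as
      soon as [4 B T <= n k] and [2 b^2 T^2 <= n k]
      ([drift_oscillation_tradeoff]); these two conditions come from the two
      terms of the minimum.

    The argument works along every axis [j]; the bound is largest when
    [beta_j] is the smallest entry. *)

(** * The regret as a function of the sum and the squared lengths *)

Section DotProduct.
Variables (R : realType) (n : nat).
Implicit Types u v w : 'cV[R]_n.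

Lemma dotpE u v : dotp u v = \sum_j u j 0 * v j 0.
Proof. by rewrite /dotp mxE; apply: eq_bigr => j _; rewrite mxE. Qed.

Lemma dotpC u v : dotp u v = dotp v u.
Proof. by rewrite !dotpE; apply: eq_bigr => j _; rewrite mulrC. Qed.

Lemma dotpDr u v w : dotp u (v + w) = dotp u v + dotp u w.
Proof. by rewrite /dotp mulmxDr mxE. Qed.

Lemma dotpZr a u v : dotp u (a *: v) = a * dotp u v.
Proof. by rewrite /dotp -scalemxAr mxE. Qed.

Lemma dotpDl u v w : dotp (v + w) u = dotp v u + dotp w u.
Proof. by rewrite !(dotpC _ u) dotpDr. Qed.

Lemma dotpZl a u v : dotp (a *: v) u = a * dotp v u.
Proof. by rewrite !(dotpC _ u) dotpZr. Qed.

Lemma dotpBr u v w : dotp u (v - w) = dotp u v - dotp u w.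
Proof. by rewrite -scaleN1r dotpDr dotpZr mulN1r. Qed.

Lemma dotp_suml m (g : 'I_m -> 'cV[R]_n) u :
  dotp (\sum_i g i) u = \sum_i dotp (g i) u.
Proof. by rewrite /dotp linear_sum /= mulmx_suml summxE. Qed.

Lemma dotp_const1 : dotp (const_mx 1 : 'cV[R]_n) (const_mx 1) = n%:R.
Proof.
rewrite dotpE (eq_bigr (fun=> 1)) ?sumr_const ?card_ord // => j _.
by rewrite !mxE mulr1.
Qed.

Lemma dotp_delta u j : dotp u (delta_mx j 0) = u j 0.
Proof.
rewrite dotpE (bigD1 j) //= big1 ?addr0 => [|l /negPf jl].
  by rewrite mxE !eqxx mulr1.
by rewrite mxE jl mulr0.
Qed.

Lemma ogdE alpha (g : seq 'cV[R]_n) i :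
  ogd alpha g i = - alpha *: \sum_(l < i) g`_l.
Proof.
elim: i => [|i IHi]; first by rewrite big_ord0 scaler0.
by rewrite big_ord_recr /= IHi scalerDr [- alpha *: g`_i]scaleNr.
Qed.

(** The square of a sum, read as the sum of its diagonal and of twice its
    strictly lower triangle. *)
Lemma sum_dotp_prefix (g : nat -> 'cV[R]_n) m :
  2 * \sum_(i < m) dotp (g i) (\sum_(l < i) g l)
    = dotp (\sum_(i < m) g i) (\sum_(i < m) g i)
      - \sum_(i < m) dotp (g i) (g i).
Proof.
elim: m => [|m IHm].
  by rewrite !big_ord0 mulr0 subr0 -(scale0r 0) dotpZr mul0r.
rewrite !big_ord_recr /= mulrDr IHm !dotpDr !dotpDl.
by rewrite (dotpC (g m) (\sum_(i < m) _)); ring.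
Qed.

Lemma regretE k alpha (g : k.-tuple 'cV[R]_n) x :
  regret alpha g x =
    alpha / 2 * (\sum_(i < k) dotp (tnth g i) (tnth g i)
                 - dotp (\sum_(i < k) tnth g i) (\sum_(i < k) tnth g i))
    - dotp (\sum_(i < k) tnth g i) x.
Proof.
have gE i : tnth g i = g`_i by apply: tnth_nth.
rewrite /regret (eq_bigr (fun i : 'I_k =>
    - alpha * dotp g`_i (\sum_(l < i) g`_l) - dotp (tnth g i) x)); last first.
  by move=> i _; rewrite dotpBr ogdE dotpZr gE.
rewrite sumrB -mulr_sumr -dotp_suml; congr (_ - _).
rewrite (eq_bigr (fun i : 'I_k => g`_i) (fun i _ => gE i)).
rewrite [X in _ = _ * (X - _)](eq_bigr (fun i : 'I_k => dotp g`_i g`_i));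
  last by move=> i _; rewrite gE.
by rewrite -opprB -(sum_dotp_prefix (fun i => g`_i)); field.
Qed.

End DotProduct.

(** * Drift plus oscillation along one axis *)

Section Zigzag.
Variables (R : realType) (n : nat) (j : 'I_n).

Definition zigzag k (c d : R) : k.-tuple 'cV[R]_n :=
  [tuple c *: const_mx 1 + (-1) ^+ i *: (d *: delta_mx j 0) | i < k].

Lemma gauge_zigzag_le k (beta : 'cV[R]_n) c d (i : 'I_k) :
    (forall l, 0 < beta l 0) -> 0 <= c -> 0 <= d ->
  gauge beta (tnth (zigzag k c d) i) <= c * norm1 beta + d * beta j 0.
Proof.
move=> beta_gt0 c_ge0 d_ge0; rewrite tnth_mktuple /gauge.
have -> : c * norm1 beta + d * beta j 0
    = \sum_l (beta l 0 * c + beta l 0 * (d * (l == j)%:R)).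
  rewrite big_split /= /norm1 mulr_sumr; congr (_ + _).
    by apply: eq_bigr => l _; rewrite gtr0_norm // mulrC.
  rewrite (bigD1 j) //= eqxx big1 => [|l /negPf ->]; last by rewrite !mulr0.
  by rewrite mulr1 addr0 mulrC.
apply: ler_sum => l _; rewrite -mulrDr ler_pM2l // !mxE mulr1 eqxx andbT.
apply: le_trans (ler_normD _ _) _.
rewrite ger0_norm // normrM normrX normrN1 expr1n mul1r ger0_norm //.
by rewrite mulr_ge0.
Qed.

Lemma sum_altsign k : \sum_(i < k) (-1) ^+ i = (odd k)%:R :> R.
Proof.
elim: k => [|k IHk]; first by rewrite big_ord0.
rewrite big_ord_recr /= {}IHk -signr_odd; case: (odd k); rewrite /= ?add0r //.
by rewrite expr1 subrr.
Qed.

(** When [k] is odd the oscillation does not cancel and contributes one term to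
    [G].  The hypothesis on [alpha] makes its interaction with the drift
    nonnegative, and the rest of it costs one of the [k] squared lengths
    [d^2]; hence the factor [k - 1]. *)
Lemma regret_zigzag_ge k (alpha c d : R) :
    0 <= alpha -> 0 <= d -> alpha * c * (k%:R - 1) <= 1 ->
  k%:R * c * n%:R - alpha * k%:R * (k%:R - 1) * n%:R * c ^+ 2 / 2
    + alpha * (k%:R - 1) * d ^+ 2 / 2
  <= regret alpha (zigzag k c d) (const_mx (- 1)).
Proof.
move=> alpha_ge0 d_ge0 drift_le.
set one := const_mx 1 : 'cV[R]_n; set e := delta_mx j 0 : 'cV[R]_n.
have ->: const_mx (- 1) = - 1 *: one.
  by apply/matrixP => p q; rewrite !mxE mulr1.
have one_e : dotp one e = 1 by rewrite dotp_delta mxE.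
have e_one : dotp e one = 1 by rewrite dotpC.
have e_e : dotp e e = 1 by rewrite dotp_delta mxE !eqxx.
have sumE : \sum_(i < k) tnth (zigzag k c d) i
    = (k%:R * c) *: one + ((odd k)%:R * d) *: e.
  under eq_bigr => i _ do rewrite tnth_mktuple.
  rewrite big_split /= sumr_const card_ord -scaler_suml sum_altsign.
  by rewrite -scaler_nat !scalerA.
have sqrE : \sum_(i < k) dotp (tnth (zigzag k c d) i) (tnth (zigzag k c d) i)
    = k%:R * (n%:R * c ^+ 2 + d ^+ 2) + (odd k)%:R * (2 * c * d).
  rewrite -sum_altsign mulr_suml.
  have -> : k%:R * (n%:R * c ^+ 2 + d ^+ 2)
      = \sum_(i < k) (n%:R * c ^+ 2 + d ^+ 2).
    by rewrite sumr_const card_ord mulr_natl.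
  rewrite -big_split /=; apply: eq_bigr => i _.
  rewrite tnth_mktuple !(dotpDl, dotpDr, dotpZl, dotpZr).
  rewrite dotp_const1 one_e e_one e_e.
  have := sqrr_sign R i; set s := (-1) ^+ i => s2.
  transitivity (n%:R * c ^+ 2 + s ^+ 2 * d ^+ 2 + s * (2 * c * d)); first ring.
  by rewrite s2 mul1r.
rewrite regretE sumE sqrE !(dotpDl, dotpDr, dotpZl, dotpZr).
rewrite dotp_const1 one_e e_one e_e.
case: (odd k) => /=.
  have : 0 <= d * (1 - alpha * c * (k%:R - 1)).
    by rewrite mulr_ge0 // subr_ge0.
  lra.
have : 0 <= alpha * d ^+ 2 by rewrite mulr_ge0 ?sqr_ge0.
lra.
Qed.

End Zigzag.

(** * Balancing drift and oscillation *)

(** With [u = alpha k], the left-hand side is the lower bound of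
    [regret_zigzag_ge] for [c = 1 / u] and [d = (1 - B / u) / b]. After
    multiplication by [2 k u b^2] the claim reads
    [(k - 1) u^2 - 2 q u + r >= 0] with [q = (k - 1) B + k b^2 T] and
    [r = (k - 1) B^2 + k (k + 1) n b^2], and [q^2 <= (k - 1) r]. *)
Lemma drift_oscillation_tradeoff (R : realFieldType) (n k u B b T : R) :
    2 <= k -> 0 <= n -> 0 < u -> 0 < b ->
    4 * B * T <= n * k -> 2 * (b * T) ^+ 2 <= n * k ->
  T <= (k + 1) * n / (2 * u) + u * (k - 1) * ((1 - B / u) / b) ^+ 2 / (2 * k).
Proof.
move=> k_ge2 n_ge0 u_gt0 b_gt0 BT bT.
have k_gt0 : 0 < k by lra.
have k1_gt0 : 0 < k - 1 by lra.
set q := (k - 1) * B + k * b ^+ 2 * T.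
set r := (k - 1) * B ^+ 2 + k * (k + 1) * n * b ^+ 2.
have disc : q ^+ 2 <= (k - 1) * r.
  (* Up to the factor [k b^2], this is the claim
     [2 (k - 1) B T + k (b T)^2 <= (k^2 - 1) n]; the hypotheses bound the left
     side by [n (k^2 - k / 2)]. *)
  have key : 2 * (k - 1) * (B * T) + k * (b * T) ^+ 2 <= (k ^+ 2 - 1) * n.
    have h1 : (k - 1) * (4 * B * T) <= (k - 1) * (n * k) by rewrite ler_pM2l.
    have h2 : k * (2 * (b * T) ^+ 2) <= k * (n * k) by rewrite ler_pM2l.
    have h3 : 0 <= n * (k - 2) by rewrite mulr_ge0 // subr_ge0.
    lra.
  have kb_ge0 : 0 <= k * b ^+ 2 by rewrite mulr_ge0 ?sqr_ge0 // ltW.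
  have := ler_wpM2l kb_ge0 key; rewrite /q /r; lra.
have quad : 0 <= (k - 1) * u ^+ 2 - 2 * q * u + r.
  rewrite -(pmulr_rge0 _ k1_gt0).
  have := sqr_ge0 ((k - 1) * u - q); lra.
rewrite -subr_ge0.
have -> : (k + 1) * n / (2 * u)
      + u * (k - 1) * ((1 - B / u) / b) ^+ 2 / (2 * k) - T
    = ((k - 1) * u ^+ 2 - 2 * q * u + r) / (2 * k * u * b ^+ 2).
  by rewrite /q /r; field; rewrite !gt_eqF.
by rewrite divr_ge0 // !mulr_ge0 ?sqr_ge0 // ltW.
Qed.

(** * The adversary *)

(** The two regimes of [alpha] are separated by whether pure drift
    [c = 1 / B] keeps the iterates played in the [k] rounds from passing the
    comparator: the last of them is [- alpha (k - 1) / B] in every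
    coordinate. *)
Lemma exists_regret_ge (R : realType) (n k : nat) (k_gt0 : (0 < k)%N)
    (alpha : R) (alpha_ge0 : 0 <= alpha) (beta : 'cV[R]_n)
    (beta_gt0 : forall l : 'I_n, 0 < beta l 0) (j : 'I_n) :
  exists g : k.-tuple 'cV[R]_n,
    (forall i : 'I_k, gauge beta (tnth g i) <= 1) /\
    2^-1 * Num.min ((n * k)%:R / (2 * norm1 beta))
                   (Num.sqrt (2 * n * k)%:R / beta j 0)
      <= regret alpha g (const_mx (- 1)).
Proof.
set B := norm1 beta; set b := beta j 0; set T := _ * Num.min _ _.
have b_gt0 : 0 < b by apply: beta_gt0.
have B_gt0 : 0 < B.
  rewrite /B /norm1 (bigD1 j) //= ltr_pwDl ?normr_gt0 ?gt_eqF //.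
  by apply: sumr_ge0.
have k_ge1 : 1 <= k%:R :> R by rewrite ler1n.
have half_gt0 : 0 < 2^-1 :> R by rewrite invr_gt0.
have T_ge0 : 0 <= T.
  rewrite mulr_ge0 ?(ltW half_gt0) // le_min.
  by rewrite !divr_ge0 ?sqrtr_ge0 ?mulr_ge0 ?ler0n ?(ltW B_gt0) ?(ltW b_gt0).
have T_le1 : T <= n%:R * k%:R / (4 * B).
  have : T <= 2^-1 * ((n * k)%:R / (2 * B)) by rewrite ler_pM2l // ge_min lexx.
  move=> /le_trans; apply; rewrite natrM le_eqVlt; apply/orP; left; apply/eqP.
  by field; rewrite gt_eqF.
have T_le2 : T <= 2^-1 * (Num.sqrt (2 * n * k)%:R / b).
  by rewrite ler_pM2l // ge_min lexx orbT.
have BT : 4 * B * T <= n%:R * k%:R.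
  by rewrite mulrC -ler_pdivlMr // mulr_gt0.
have bT : 2 * (b * T) ^+ 2 <= n%:R * k%:R.
  have : b * T <= 2^-1 * Num.sqrt (2 * n * k)%:R.
    by rewrite mulrC -ler_pdivlMr // -mulrA.
  rewrite -(ler_pXn2r (n := 2)) ?nnegrE //; last 2 first.
  - by rewrite (mulr_ge0 (ltW b_gt0) T_ge0).
  - by rewrite (mulr_ge0 (ltW half_gt0) (sqrtr_ge0 _)).
  rewrite [leRHS]exprMn sqr_sqrtr ?ler0n // !natrM; lra.
have [small|large] := leP (alpha * (k%:R - 1)) B.
- exists (zigzag j k B^-1 0); split=> [i|].
    apply: le_trans (gauge_zigzag_le _ _ _ _ _) _ => //.
      by rewrite invr_ge0 ltW.
    by rewrite mul0r addr0 mulVf ?gt_eqF.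
  apply: le_trans (regret_zigzag_ge _ _ _ _) => //; last first.
    by rewrite mulrAC ler_pdivrMr ?mul1r.
  apply: le_trans T_le1 _.
  rewrite -subr_ge0.
  have -> : k%:R / B * n%:R
        - alpha * k%:R * (k%:R - 1) * n%:R * B^-1 ^+ 2 / 2
        + alpha * (k%:R - 1) * 0 ^+ 2 / 2 - n%:R * k%:R / (4 * B)
      = n%:R * k%:R * (B + 2 * (B - alpha * (k%:R - 1))) / (4 * B ^+ 2).
    by field; rewrite gt_eqF.
  rewrite divr_ge0 ?(mulr_ge0 _ (sqr_ge0 _)) //.
  by rewrite !mulr_ge0 ?ler0n //; lra.
- have k_ge2 : 2 <= k%:R :> R.
    rewrite ler_nat ltnNge; apply/negP => k_le1; move: large.
    have -> : k = 1%N by apply/eqP; rewrite eqn_leq k_le1.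
    by rewrite subrr mulr0 ltNge ltW.
  have alpha_gt0 : 0 < alpha.
    rewrite lt0r alpha_ge0 andbT; apply/eqP => alpha0; move: large.
    by rewrite alpha0 mul0r ltNge ltW.
  have u_gt0 : 0 < alpha * k%:R by rewrite mulr_gt0 // (lt_le_trans _ k_ge1).
  have B_le : B <= alpha * k%:R by lra.
  have c_ge0 : 0 <= (alpha * k%:R)^-1 by rewrite invr_ge0 ltW.
  have d_ge0 : 0 <= (1 - B / (alpha * k%:R)) / b.
    by rewrite divr_ge0 ?(ltW b_gt0) // subr_ge0 ler_pdivrMr ?mul1r.
  exists (zigzag j k (alpha * k%:R)^-1 ((1 - B / (alpha * k%:R)) / b)).
  split=> [i|].
    apply: le_trans (gauge_zigzag_le _ _ _ _ _) _ => //.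
    rewrite divfK ?gt_eqF // mulrC -/B; lra.
  apply: le_trans (regret_zigzag_ge _ _ _ _) => //; last first.
    by rewrite mulrAC ler_pdivrMr // mul1r; lra.
  have n_ge0 : 0 <= n%:R :> R by apply: ler0n.
  apply: le_trans
    (drift_oscillation_tradeoff k_ge2 n_ge0 u_gt0 b_gt0 BT bT) _.
  rewrite le_eqVlt; apply/orP; left; apply/eqP.
  have k_neq0 : k%:R != 0 :> R by rewrite gt_eqF // (lt_le_trans _ k_ge1).
  by field; rewrite k_neq0 !gt_eqF.
Qed.

Theorem theorem6 (R : realType) (n k : nat) (n_gt0 : (0 < n)%N)
    (k_gt0 : (0 < k)%N) (alpha : R) (alpha_ge0 : 0 <= alpha)
    (beta : 'cV[R]_n) (beta_gt0 : forall j : 'I_n, 0 < beta j 0) :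
  exists (g : k.-tuple 'cV[R]_n) (x : 'cV[R]_n),
    [/\ forall i : 'I_k, gauge beta (tnth g i) <= 1,
        in_cube x
      & regret alpha g x >=
          2^-1 * Num.min ((n * k)%:R / (2 * norm1 beta))
                         (Num.sqrt (2 * n * k)%:R / min_entry n_gt0 beta)].
Proof.
have [g [g_gauge g_regret]] := exists_regret_ge k_gt0 alpha_ge0 beta_gt0
  [arg min_(l < Ordinal n_gt0) beta l 0]%O.
exists g, (const_mx (- 1)); split=> // j.
by rewrite mxE lexx; lra.
Qed.
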